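(* Let $P_1=x\frac{d}{dx}\frac{d}{dx}+y\frac{d}{dx}\frac{d}{dy}$ on $\mathbb{C}\langle x,y\rangle$. For $f\in\mathbb{C}\langle x,y\rangle$ we have, in $T/[T,T]$, $$d^0_{P_1}(f)=\left(y\frac{df}{dy}''\frac{df}{dy}'\right)\frac{d}{dx}-\left(y\frac{df}{dx}''\frac{df}{dx}'\right)\frac{d}{dy}.$$ Consequently $$H^0_{P_1}(\mathbb{C}\langle x,y\rangle)=\mathbb{C}.$$
   Context: $\mathbb{C}$ is an algebraically closed field of characteristic $0$. Let $A=\mathbb{C}\langle x,y\rangle$. $\frac{d}{dx},\frac{d}{dy}:A\to A\otimes A$ are the derivations for the outer bimodule structure $a(a'\otimes a'')b=aa'\otimes a''b$ with $\frac{d}{dx}(x)=1\otimes1$, $\frac{d}{dx}(y)=0$, $\frac{d}{dy}(y)=1\otimes1$, $\frac{d}{dy}(x)=0$; Sweedler notation: $\frac{df}{dx}=\frac{df}{dx}'\otimes\frac{df}{dx}''$ (summation understood), similarly for $y$. $T=T_A$, the tensor algebra of the $A$-bimodule of double derivations $\mathrm{Der}(A,A\otimes A)$, is the free algebra on $x,y,\frac{d}{dx},\frac{d}{dy}$, graded with $|x|=|y|=0$ and $|\frac{d}{dx}|=|\frac{d}{dy}|=1$. $[T,T]$ is the span of supercommutators $uv-(-1)^{|u||v|}vu$. The double Schouten bracket is the unique bilinear $\{\!\!\{-,-\}\!\!\}:T\otimes T\to T\otimes T$ vanishing on pairs from $\{x,y\}$ and on pairs from $\{\frac d{dx},\frac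 d{dy}\}$, with $\{\!\!\{\delta,a\}\!\!\}=\delta(a)$ for $\delta\in\{\frac d{dx},\frac d{dy}\}$, $a\in\{x,y\}$, and, for homogeneous $u,v,w$, $\{\!\!\{u,vw\}\!\!\}=(-1)^{(|u|-1)|v|}v\{\!\!\{u,w\}\!\!\}+\{\!\!\{u,v\}\!\!\}w$, $\{\!\!\{u,v\}\!\!\}=-(-1)^{(|u|-1)(|v|-1)}\sigma\{\!\!\{v,u\}\!\!\}$, $\sigma(a\otimes b)=(-1)^{|a||b|}b\otimes a$. Then $\{-,-\}=\mu\circ\{\!\!\{-,-\}\!\!\}$ ($\mu$ the multiplication) induces a bracket on $T/[T,T]$. For a double Poisson tensor $P$ (degree $2$ with $\{P,P\}=0$ in $T/[T,T]$) the map $d_P=\{P,-\}$ is a differential of degree $+1$ on $T/[T,T]$; $d_P^i$ is its restriction to $(T/[T,T])_i$, and $H^i_P(A)$ is the cohomology at $(T/[T,T])_i$; in particular $H^0_P(A)=\ker(d_P^0:A/[A,A]\to(T/[T,T])_1)$. *)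

(* Defs.v *)
From HB Require Import structures.
From mathcomp Require Import all_boot all_order all_algebra.
From mathcomp Require Import finmap monalg boolp.

Set Implicit Arguments.
Unset Strict Implicit.
Unset Printing Implicit Defensive.

Import GRing.Theory.
Local Open Scope ring_scope.
Local Open Scope quotient_scope.

Lemma cat_eq_nil (X : Type) (u v : seq X) :
  u ++ v = [::] -> u = [::] /\ v = [::].
Proof. by case: u; case: v. Qed.

HB.instance Definition _ (X : choiceType) :=
  Choice_isMonomialDef.Build (seq X)
    (@catA X) (@cat0s X) (@cats0 X) (@cat_eq_nil X).

Lemma malg_scaleAr (C : comNzRingType) (M : monomType)
  (c : C) (f g : {malg C[M]}) : c *: (f * g) = f * (c *: g).
Proof.
apply/malgP=> k; rewrite mcoeffZ !(mcoeffMlw k (fsubset_refl _) (msuppZ_le c g)).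
rewrite (mcoeffMlw k (fsubset_refl _) (fsubset_refl _)) mulr_sumr.
apply: eq_bigr => i _; rewrite mulr_sumr; apply: eq_bigr => j _.
by rewrite mcoeffZ mulrnAr mulrCA.
Qed.

Section LinearExtension.
Variables (C : comNzRingType) (K : choiceType) (V : lmodType C).

Definition lext (h : K -> V) (f : {malg C[K]}) : V :=
  \sum_(k <- msupp f) f@_k *: h k.

Lemma lextE h f : lext h f = \sum_(k <- msupp f) f@_k *: h k.
Proof. by []. Qed.

Lemma lextEw h (d : {fset K}) f : (msupp f `<=` d)%fset ->
  lext h f = \sum_(k <- d) f@_k *: h k.
Proof.
move=> le; rewrite /lext (big_fset_incl _ le) //= => x _ /mcoeff_outdom ->.
by rewrite scale0r.
Qed.

Lemma lext_linear h : linear (lext h).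
Proof.
move=> c f g; pose d := (msupp f `|` msupp g)%fset.
have sf : (msupp f `<=` d)%fset by exact: fsubsetUl.
have sg : (msupp g `<=` d)%fset by exact: fsubsetUr.
have s : (msupp (c *: f + g) `<=` d)%fset.
  apply: fsubset_trans (msuppD_le _ _) _.
  by rewrite fsubUset sg andbT (fsubset_trans (msuppZ_le _ _)).
rewrite (lextEw h s) (lextEw h sf) (lextEw h sg) scaler_sumr -big_split /=.
by apply: eq_bigr => k _; rewrite mcoeffD mcoeffZ scalerDl scalerA.
Qed.

HB.instance Definition _ h :=
  GRing.isLinear.Build C {malg C[K]} V _ (lext h) (lext_linear h).

Lemma lextU h k : lext h << k >> = h k.
Proof. by rewrite /lext msuppU oner_eq0 big_seq_fset1 mcoeffUU scale1r. Qed.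

Lemma malgZU c (k : K) : << c *g k >> = c *: << k >> :> {malg C[K]}.
Proof. by apply/malgP=> l; rewrite mcoeffZ !mcoeffU mulrnAr mulr1. Qed.

Lemma linear_eq_on (f g : {malg C[K]} -> V) (u : {malg C[K]}) :
  linear f -> linear g -> {in msupp u, forall k, f << k >> = g << k >>} ->
  f u = g u.
Proof.
move=> lf lg fg.
pose F : {linear _ -> _} := HB.pack f (GRing.isLinear.Build _ _ _ _ f lf).
pose G : {linear _ -> _} := HB.pack g (GRing.isLinear.Build _ _ _ _ g lg).
rewrite (monalgE u) -[f]/(F : _ -> _) -[g]/(G : _ -> _) !linear_sum !big_seq.
by apply: eq_bigr => k ku; rewrite malgZU !linearZ /= fg.
Qed.

End LinearExtension.

Lemma malgUM (C : comNzRingType) (X : choiceType) (u v : seq X) :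
  << u >> * << v >> = << u ++ v >> :> {malg C[seq X]}.
Proof. by rewrite malgM_def fgmulUU mulr1. Qed.

(* [splits w] lists the factorisations [w = p ++ a :: q] as triples *)
(* [(p, a, q)]                                                       *)
Fixpoint splits (X : Type) (w : seq X) : seq (seq X * X * seq X) :=
  if w is a :: w' then
    ([::], a, w') :: [seq (a :: s.1.1, s.1.2, s.2) | s <- splits w']
  else [::].

Lemma splits_cat (X : Type) (v w : seq X) :
  splits (v ++ w) = [seq (s.1.1, s.1.2, s.2 ++ w) | s <- splits v]
                 ++ [seq (v ++ s.1.1, s.1.2, s.2) | s <- splits w].
Proof.
elim: v => [|a v IH] /=; first by rewrite -[LHS]map_id; apply: eq_map => -[[]].
by rewrite IH map_cat -!map_comp.
Qed.

Lemma splitsP (X : eqType) (w : seq X) s :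
  s \in splits w -> w = s.1.1 ++ s.1.2 :: s.2.
Proof.
elim: w s => //= a w IH s; rewrite inE => /orP[/eqP-> //|/mapP[t /IH wE ->]] /=.
by rewrite -wE.
Qed.

(* The tensor square of the free module on [seq X] is the free module on   *)
(* pairs of words, [<< (p, q) >>] standing for the pure tensor of p and q. *)
Notation tsquare C X := {malg C[(seq X * seq X)%type]}.

Section TensorSquare.
Variables (C : comNzRingType) (X : choiceType).
Implicit Types (a b f : {malg C[seq X]}) (t : tsquare C X).

Definition tensor a b : tsquare C X :=
  lext (fun p => lext (fun q => << (p, q) >>) b) a.

(* a (t' (x) t'') b = a t' (x) t'' b *)
Definition outer a t b : tsquare C X :=
  lext (fun pq => tensor (a * << pq.1 >>) (<< pq.2 >> * b)) t.

Definition tmul t : {malg C[seq X]} := lext (fun pq => << pq.1 ++ pq.2 >>) t.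

(* t' (x) t'' |-> t'' t' *)
Definition tmul_op t : {malg C[seq X]} := lext (fun pq => << pq.2 ++ pq.1 >>) t.

Lemma lext_fun_linear (K L : choiceType) (h : K -> L -> tsquare C X)
  (g : {malg C[L]}) (f : {malg C[K]}) :
  lext (fun p => lext (h p) g) f = lext (fun q => lext (h^~ q) f) g.
Proof.
rewrite /lext; under eq_bigr do rewrite scaler_sumr.
rewrite exchange_big /=; apply: eq_bigr => q _; rewrite scaler_sumr.
by apply: eq_bigr => p _; rewrite !scalerA mulrC.
Qed.

Lemma tensor_linl b : linear (tensor^~ b). Proof. exact: lext_linear. Qed.

Lemma tensor_linr a : linear (tensor a).
Proof.
have e b : tensor a b = lext (fun q => lext (fun p => << (p, q) >>) a) b.
  exact: lext_fun_linear.
by move=> c f g; rewrite !e; apply: lext_linear.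
Qed.

Lemma tensorU u v : tensor << u >> << v >> = << (u, v) >>.
Proof. by rewrite /tensor !lextU. Qed.

Lemma outer_lin a b : linear (fun t => outer a t b).
Proof. exact: lext_linear. Qed.

Lemma lext_sum_fun (K : choiceType) c (h1 h2 : K -> tsquare C X)
  (f : {malg C[K]}) :
  lext (fun k => c *: h1 k + h2 k) f = c *: lext h1 f + lext h2 f.
Proof.
rewrite /lext scaler_sumr -big_split; apply: eq_bigr => k _ /=.
by rewrite scalerDr !scalerA mulrC.
Qed.

Lemma eq_lext (K : choiceType) (h1 h2 : K -> tsquare C X) :
  h1 =1 h2 -> lext h1 =1 lext h2.
Proof. by move=> e f; apply: eq_bigr => k _; rewrite e. Qed.

Lemma outer_linl t b : linear (fun a => outer a t b).
Proof.
move=> c f g; rewrite -lext_sum_fun; apply: eq_lext => k.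
by rewrite mulrDl -scalerAl tensor_linl.
Qed.

Lemma outer_linr t a : linear (fun b => outer a t b).
Proof.
move=> c f g; rewrite -lext_sum_fun; apply: eq_lext => k.
by rewrite mulrDr -malg_scaleAr tensor_linr.
Qed.

Lemma outerU u p q v :
  outer << u >> << (p, q) >> << v >> = << (u ++ p, q ++ v) >>.
Proof. by rewrite /outer lextU !malgUM tensorU. Qed.

End TensorSquare.

(* keeps failing unifications short *)
Local Opaque lext.

Section SpanQuotient.
Variables (C : comNzRingType) (V : lmodType C) (S : V -> Prop).

Inductive in_span : V -> Prop :=
| in_span0 : in_span 0
| in_spanD c s v : S s -> in_span v -> in_span (c *: s + v).

Definition span : {pred V} := fun v => `[< in_span v >].

Lemma spanP v : reflect (in_span v) (v \in span).
Proof. exact: asboolP. Qed.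

Lemma span_gen s : S s -> s \in span.
Proof.
move=> Ss; apply/spanP; rewrite -[s]scale1r -[1 *: s]addr0.
exact: in_spanD in_span0.
Qed.

Lemma span_submod : submod_closed span.
Proof.
split=> [|c u v /spanP su /spanP sv]; first exact/spanP/in_span0.
apply/spanP; elim: su => [|d s w Ss _ IH]; first by rewrite scaler0 add0r.
by rewrite scalerDr scalerA -addrA; apply: in_spanD.
Qed.

HB.instance Definition _ := GRing.isSubmodClosed.Build C V span span_submod.

Definition quot_span := Quotient.quot span.

HB.instance Definition _ := GRing.Zmodule.on quot_span.

Definition cls (v : V) : quot_span := \pi_(quot_span) v.
Definition rep (q : quot_span) : V := repr q.

Lemma repK : cancel rep cls. Proof. exact: reprK. Qed.

Lemma cls_eqE u v : (cls u == cls v) = (u - v \in span).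
Proof. by rewrite /cls -Quotient.idealrBE. Qed.

Lemma clsD u v : cls (u + v) = cls u + cls v.
Proof. by rewrite /cls !piE. Qed.

Definition scaleq (c : C) (q : quot_span) : quot_span := cls (c *: rep q).

Lemma scaleq_cls c v : scaleq c (cls v) = cls (c *: v).
Proof.
apply/eqP; rewrite cls_eqE -scalerBr rpredZ // -cls_eqE.
by apply/eqP; exact: repK.
Qed.

Lemma scaleqA c d q : scaleq c (scaleq d q) = scaleq (c * d) q.
Proof. by rewrite -[q]repK !scaleq_cls scalerA. Qed.

Lemma scale1q : left_id 1 scaleq.
Proof. by move=> q; rewrite -[q]repK scaleq_cls scale1r. Qed.

Lemma scaleqDr : right_distributive scaleq +%R.
Proof.
move=> c p q; rewrite -[p]repK -[q]repK -clsD !scaleq_cls -clsD.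
by rewrite scalerDr.
Qed.

Lemma scaleqDl q : {morph scaleq^~ q : c d / c + d}.
Proof. by move=> c d; rewrite -[q]repK !scaleq_cls -clsD scalerDl. Qed.

HB.instance Definition _ :=
  GRing.Zmodule_isLmodule.Build C quot_span scaleqA scale1q scaleqDr scaleqDl.

Lemma cls_linear : linear cls.
Proof. by move=> c u v; rewrite clsD -scaleq_cls. Qed.

HB.instance Definition _ :=
  GRing.isLinear.Build C V quot_span _ cls cls_linear.

End SpanQuotient.

Variant var := X | Y.

Definition bool_of_var a := if a is X then true else false.
Definition var_of_bool b := if b then X else Y.
Lemma bool_of_varK : cancel bool_of_var var_of_bool. Proof. by case. Qed.
HB.instance Definition _ := Countable.copy var (can_type bool_of_varK).

(* [Coord X], [Coord Y] are x, y and [Der X], [Der Y] are d/dx, d/dy *)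
Variant letter := Coord of var | Der of var.

Definition sum_of_letter l : var + var :=
  match l with Coord a => inl a | Der a => inr a end.
Definition letter_of_sum s :=
  match s with inl a => Coord a | inr a => Der a end.
Lemma sum_of_letterK : cancel sum_of_letter letter_of_sum. Proof. by case. Qed.
HB.instance Definition _ := Countable.copy letter (can_type sum_of_letterK).

Definition deg1 (l : letter) : nat := if l is Der _ then 1 else 0.
Definition deg (w : seq letter) : nat := \sum_(l <- w) deg1 l.

Lemma deg_nil : deg [::] = 0%N. Proof. exact: big_nil. Qed.
Lemma deg_cons l w : deg (l :: w) = (deg1 l + deg w)%N.
Proof. exact: big_cons. Qed.
Lemma deg_cat u v : deg (u ++ v) = (deg u + deg v)%N.
Proof. exact: big_cat. Qed.

(* [freeA C] is C<x, y> and [freeT C] is its algebra of poly-vector fields *)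
Notation freeA C := {malg C[seq var]}.
Notation freeT C := {malg C[seq letter]}.

Section FreeAlgebras.
Variable C : comNzRingType.
Local Notation A := (freeA C).
Local Notation AA := (tsquare C var).
Local Notation T := (freeT C).
Local Notation TT := (tsquare C letter).

Definition gen (a : var) : A := << [:: a] >>.
Definition coord (a : var) : T := << [:: Coord a] >>.
Definition der (a : var) : T := << [:: Der a] >>.

Definition inclT (f : A) : T := lext (fun w => << map Coord w >>) f.
Definition inclTT (t : AA) : TT :=
  lext (fun pq => << (map Coord pq.1, map Coord pq.2) >>) t.

Definition homog (d : nat) (u : T) := {in msupp u, forall w, deg w = d}.

(* the double derivation d/da *)
Definition ddword (a : var) (w : seq var) : AA :=
  \sum_(s <- splits w | s.1.2 == a) << (s.1.1, s.2) >>.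
Definition dd (a : var) (f : A) : AA := lext (ddword a) f.

Definition double_derivation (D : A -> AA) :=
  linear D /\ forall f g, D (f * g) = outer f (D g) 1 + outer 1 (D f) g.

(* On letters the bracket takes values in the multiples of 1 (x) 1. *)
Definition letter_bracket (l m : letter) : C :=
  match l, m with
  | Der a, Coord b => (a == b)%:R
  | Coord b, Der a => - (a == b)%:R
  | _, _ => 0
  end.

(* Closed form of the double Schouten bracket of two words, obtained by      *)
(* unfolding the Leibniz rule in both arguments; [schoutenP] and             *)
(* [schouten_uniq] below show that it is the bracket defined by the axioms.  *)
Definition schouten_word (u v : seq letter) : TT :=
  \sum_(s <- splits u) \sum_(t <- splits v)
    ((-1) ^+ ((deg u).+1 * deg t.1.1 + (deg s.1.1 + deg1 s.1.2) * deg s.2)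
       * letter_bracket s.1.2 t.1.2)
      *: << (t.1.1 ++ s.2, s.1.1 ++ t.2) >>.

Definition schouten (f g : T) : TT :=
  lext (fun u => lext (schouten_word u) g) f.

Definition sigma (t : TT) : TT :=
  lext (fun pq => (-1) ^+ (deg pq.1 * deg pq.2) *: << (pq.2, pq.1) >>) t.

(* The integer |u| - 1 only enters through its parity, which is that of     *)
(* [m.+1] for [u] of degree [m].                                            *)
Record double_schouten (db : T -> T -> TT) : Prop := DoubleSchouten {
  ds_linl : forall g, linear (db^~ g);
  ds_linr : forall f, linear (db f);
  ds_coord : forall a b, db (coord a) (coord b) = 0;
  ds_der : forall a b, db (der a) (der b) = 0;
  ds_der_coord : forall a b, db (der a) (coord b) = inclTT (dd a (gen b));
  ds_leibniz : forall m n p u v w, homog m u -> homog n v -> homog p w ->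
    db u (v * w) = (-1) ^+ (m.+1 * n) *: outer v (db u w) 1
                   + outer 1 (db u v) w;
  ds_anti : forall m n u v, homog m u -> homog n v ->
    db u v = - ((-1) ^+ (m.+1 * n.+1) *: sigma (db v u))
}.

Definition bracket (f g : T) : T := tmul (schouten f g).

Definition P1 : T := coord X * der X * der X + coord Y * der X * der Y.

Definition commutator (f : A) : Prop := exists u v, f = u * v - v * u.

Definition supercommutator (f : T) : Prop :=
  exists m n u v, [/\ homog m u, homog n v &
                      f = u * v - (-1) ^+ (m * n) *: (v * u)].

Lemma homogU (w : seq letter) : homog (deg w) << w >>.
Proof. by move=> v; rewrite msuppU oner_eq0 inE => /eqP->. Qed.
Arguments homogU : clear implicits.

Lemma oneU (L : choiceType) : 1 = << [::] >> :> {malg C[seq L]}.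
Proof. by []. Qed.

Lemma mull_linear (L : choiceType) (f : {malg C[seq L]}) : linear ( *%R f).
Proof. by move=> c g h; rewrite mulrDr malg_scaleAr. Qed.

Lemma mulr_linear (L : choiceType) (f : {malg C[seq L]}) : linear ( *%R^~ f).
Proof. by move=> c g h; rewrite mulrDl scalerAl. Qed.

Lemma add_linear (U V : lmodType C) (f g : U -> V) :
  linear f -> linear g -> linear (fun x => f x + g x).
Proof. by move=> lf lg c x y; rewrite lf lg scalerDr addrACA. Qed.

Lemma comp_linear (U V W : lmodType C) (f : V -> W) (g : U -> V) :
  linear f -> linear g -> linear (f \o g).
Proof. by move=> lf lg c x y; rewrite /= lg lf. Qed.

Lemma scale_linear (U V : lmodType C) c (f : U -> V) :
  linear f -> linear (fun x => c *: f x).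
Proof. by move=> lf k x y; rewrite lf scalerDr !scalerA mulrC. Qed.

Lemma linear0' (U V : lmodType C) (f : U -> V) : linear f -> f 0 = 0.
Proof.
by move=> lf; have := lf (-1) 0 0; rewrite !scaleN1r oppr0 addr0 addNr.
Qed.

Lemma linearZ' (U V : lmodType C) (f : U -> V) c x :
  linear f -> f (c *: x) = c *: f x.
Proof. by move=> lf; rewrite -[c *: x]addr0 lf linear0' ?addr0. Qed.

Lemma linear_sum' (U V : lmodType C) (f : U -> V) (I : Type) (r : seq I) P F :
  linear f -> f (\sum_(i <- r | P i) F i) = \sum_(i <- r | P i) f (F i).
Proof.
move=> lf; apply: (big_morph f) => [x y|]; last exact: linear0'.
by rewrite -[x]scale1r lf !scale1r.
Qed.

Lemma scaler_sum' (V : lmodType C) c (I : Type) (r : seq I) P (F : I -> V) :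
  c *: (\sum_(i <- r | P i) F i) = \sum_(i <- r | P i) c *: F i.
Proof. exact: scaler_sumr. Qed.

Lemma linear_eq (K : choiceType) (V : lmodType C) (f g : {malg C[K]} -> V) :
  linear f -> linear g -> (forall k, f << k >> = g << k >>) -> f =1 g.
Proof. by move=> lf lg e u; apply: linear_eq_on. Qed.

Lemma schouten_linl g : linear (schouten^~ g).
Proof. exact: lext_linear. Qed.

Lemma schouten_linr f : linear (schouten f).
Proof.
move=> c g h; rewrite -lext_sum_fun; apply: eq_lext => u; exact: lext_linear.
Qed.

Lemma schoutenU u v : schouten << u >> << v >> = schouten_word u v.
Proof. by rewrite /schouten !lextU. Qed.

Lemma eq_sign (m n : nat) : odd m = odd n -> (-1) ^+ m = (-1) ^+ n :> C.
Proof. by move=> e; rewrite -signr_odd e signr_odd. Qed.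

Lemma schouten_word_cat u v w : schouten_word u (v ++ w) =
  (-1) ^+ ((deg u).+1 * deg v) *: outer << v >> (schouten_word u w) 1
  + outer 1 (schouten_word u v) << w >>.
Proof.
rewrite /schouten_word addrC !oneU.
rewrite (linear_sum' _ _ _ (outer_lin _ _)) (linear_sum' _ _ _ (outer_lin _ _)).
rewrite scaler_sum' -big_split /=; apply: eq_bigr => s _.
rewrite splits_cat big_cat !big_map /=.
rewrite (linear_sum' _ _ _ (outer_lin _ _)) (linear_sum' _ _ _ (outer_lin _ _)).
congr (_ + _); [|rewrite scaler_sum']; apply: eq_bigr => t _;
  rewrite (linearZ' _ _ (outer_lin _ _)) outerU ?catA ?cats0 //.
rewrite scalerA mulrA -exprD; congr (_ ^+ _ * _ *: << _ >>).
by rewrite deg_cat mulnDr addnA.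
Qed.

Lemma schouten_word_anti u v : schouten_word u v =
  - ((-1) ^+ ((deg u).+1 * (deg v).+1) *: sigma (schouten_word v u)).
Proof.
rewrite /schouten_word exchange_big /= /sigma
  (linear_sum' _ _ _ (lext_linear _)) scaler_sum' -sumrN.
rewrite !big_seq; apply: eq_bigr => t /splitsP vE.
rewrite (linear_sum' _ _ _ (lext_linear _)) scaler_sum' -sumrN !big_seq; apply: eq_bigr => s /splitsP uE.
rewrite (linearZ' _ _ (lext_linear _)) lextU !scalerA -scaleNr /=; congr (_ *: _).
rewrite mulrA mulrAC -mulrA mulrCA mulrA -!exprD.
have [d|] := boolP (deg1 s.1.2 + deg1 t.1.2 == 1)%N; last first.
  by case: s.1.2 t.1.2 => a [] b //=; rewrite !mulr0 oppr0.
have -> : letter_bracket t.1.2 s.1.2 = - letter_bracket s.1.2 t.1.2.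
  by case: s.1.2 t.1.2 {d} => a [] b //=; rewrite ?oppr0 ?opprK // eq_sym.
rewrite mulrN opprK; congr (_ * _); apply: eq_sign.
rewrite uE vE !deg_cat !deg_cons.
have {d} -> : deg1 t.1.2 = ~~ odd (deg1 s.1.2) :> nat.
  by case: s.1.2 t.1.2 d => a [] b.
move: (deg1 s.1.2) (deg s.1.1) (deg s.2) (deg t.1.1) (deg t.2) => p a b a' b'.
rewrite !(oddD, oddM, oddS, oddb) /= ?(oddD, oddM, oddS, oddb).
by case: (odd p) (odd a) (odd b) (odd a') (odd b') => [] [] [] [] [].
Qed.

Lemma in_homogP d (u : T) w : homog d u -> w \in msupp u -> deg w = d.
Proof. by apply. Qed.

Lemma sigma_linear : linear sigma. Proof. exact: lext_linear. Qed.

Lemma tmul_linear L : linear (@tmul C L). Proof. exact: lext_linear. Qed.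

Lemma schouten_leibniz m n u v w : homog m u -> homog n v ->
  schouten u (v * w) = (-1) ^+ (m.+1 * n) *: outer v (schouten u w) 1
                       + outer 1 (schouten u v) w.
Proof.
move=> hu hv.
apply: (linear_eq (f := fun w => schouten u (v * w))
  (g := fun w => (-1) ^+ (m.+1 * n) *: outer v (schouten u w) 1
                 + outer 1 (schouten u v) w)) => [||{}w].
- exact: (comp_linear (schouten_linr u) (mull_linear v)).
- apply: add_linear (outer_linr _ _); apply: scale_linear.
  exact: (comp_linear (outer_lin v 1) (schouten_linr u)).
apply: (linear_eq_on (f := fun v => schouten u (v * << w >>))
  (g := fun v => (-1) ^+ (m.+1 * n) *: outer v (schouten u << w >>) 1
                 + outer 1 (schouten u v) << w >>)) => [||v' /hv <-].
- exact: (comp_linear (schouten_linr u) (mulr_linear << w >>)).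
- apply: add_linear; first exact: scale_linear (outer_linl _ _).
  exact: (comp_linear (outer_lin 1 << w >>) (schouten_linr u)).
apply: (linear_eq_on (f := fun u => schouten u (<< v' >> * << w >>))
  (g := fun u => (-1) ^+ (m.+1 * deg v') *: outer << v' >> (schouten u << w >>) 1
                 + outer 1 (schouten u << v' >>) << w >>)) => [||u' /hu <-].
- exact: schouten_linl.
- apply: add_linear; first apply: scale_linear.
    exact: (comp_linear (outer_lin << v' >> 1) (schouten_linl << w >>)).
  exact: (comp_linear (outer_lin 1 << w >>) (schouten_linl << v' >>)).
by rewrite malgUM !schoutenU schouten_word_cat.
Qed.

Lemma schouten_anti m n u v : homog m u -> homog n v ->
  schouten u v = - ((-1) ^+ (m.+1 * n.+1) *: sigma (schouten v u)).
Proof.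
move=> hu hv; rewrite -scaleNr.
apply: (linear_eq_on (f := schouten u)
  (g := fun v => - (-1) ^+ (m.+1 * n.+1) *: sigma (schouten v u)))
  => [||v' /hv <-].
- exact: schouten_linr.
- apply: scale_linear; exact: (comp_linear sigma_linear (schouten_linl u)).
apply: (linear_eq_on (f := fun u => schouten u << v' >>)
  (g := fun u => - (-1) ^+ (m.+1 * (deg v').+1) *: sigma (schouten << v' >> u)))
  => [||u' /hu <-].
- exact: schouten_linl.
- apply: scale_linear; exact: (comp_linear sigma_linear (schouten_linr << v' >>)).
by rewrite !schoutenU schouten_word_anti scaleNr.
Qed.

Lemma schouten_letter l m :
  schouten << [:: l] >> << [:: m] >> = letter_bracket l m *: << ([::], [::]) >>.
Proof.
by rewrite schoutenU /schouten_word /= !big_seq1 /= deg_nil !muln0 mul1r.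
Qed.

Lemma dd_gen a b : dd a (gen b) = (a == b)%:R *: << ([::], [::]) >>.
Proof.
rewrite /dd lextU /ddword /= big_mkcond big_seq1 /= eq_sym.
by case: eqP => _; rewrite ?scale1r ?scale0r.
Qed.

Lemma inclTT_linear : linear inclTT. Proof. exact: lext_linear. Qed.

Lemma schoutenP : double_schouten schouten.
Proof.
split; first exact: schouten_linl.
- exact: schouten_linr.
- by move=> a b; rewrite schouten_letter scale0r.
- by move=> a b; rewrite schouten_letter scale0r.
- move=> a b; rewrite schouten_letter dd_gen (linearZ' _ _ inclTT_linear).
  by rewrite /inclTT lextU.
- by move=> m n _ u v w hu hv _; apply: schouten_leibniz.
- exact: schouten_anti.
Qed.

Lemma double_schouten_nil db u : double_schouten db ->
  db << u >> << [::] >> = 0.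
Proof.
move=> H; have h1 : homog 0 (<< [::] >> : T) by rewrite -deg_nil; apply: homogU.
have := ds_leibniz H (homogU u) h1 h1.
rewrite malgUM /= muln0 scale1r.
have o1 : forall t : TT, outer << [::] >> t << [::] >> = t.
  apply: linear_eq => [||[p q]]; first exact: outer_lin.
    by [].
  by rewrite outerU cats0.
by rewrite !oneU !o1 -[LHS]addr0 => /addrI.
Qed.

Lemma schouten_uniq db : double_schouten db -> forall f g, db f g = schouten f g.
Proof.
move=> H f g; have S := schoutenP.
have letters l m : db << [:: l] >> << [:: m] >>
                   = schouten << [:: l] >> << [:: m] >>.
  case: l m => a [] b.
  - by rewrite (ds_coord H) (ds_coord S).
  - rewrite (ds_anti H (homogU [:: Coord a]) (homogU [:: Der b])).
    rewrite (ds_anti S (homogU [:: Coord a]) (homogU [:: Der b])).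
    by rewrite (ds_der_coord H) (ds_der_coord S).
  - by rewrite (ds_der_coord H) (ds_der_coord S).
  by rewrite (ds_der H) (ds_der S).
have ext u : (forall l, db << u >> << [:: l] >> = schouten << u >> << [:: l] >>)
    -> forall v, db << u >> << v >> = schouten << u >> << v >>.
  move=> ul; elim=> [|l v IH].
    by rewrite (double_schouten_nil _ H) (double_schouten_nil _ S).
  rewrite -cat1s -malgUM.
  rewrite (ds_leibniz H (homogU u) (homogU [:: l]) (homogU v)).
  by rewrite (ds_leibniz S (homogU u) (homogU [:: l]) (homogU v)) IH ul.
have words u v : db << u >> << v >> = schouten << u >> << v >>.
  apply: (ext) => l.
  rewrite (ds_anti H (homogU u) (homogU [:: l])).
  rewrite (ds_anti S (homogU u) (homogU [:: l])).
  by rewrite (ext [:: l] (letters l)).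
apply: (linear_eq (ds_linr H f) (schouten_linr f)) => v.
exact: (linear_eq (ds_linl H << v >>) (schouten_linl << v >>)).
Qed.

Lemma ddP a : double_derivation (dd a).
Proof.
split=> [|f g]; first exact: lext_linear.
apply: (linear_eq (f := fun g => dd a (f * g))
  (g := fun g => outer f (dd a g) 1 + outer 1 (dd a f) g)) => [||{}g].
- exact: (comp_linear (lext_linear _) (mull_linear f)).
- apply: add_linear (outer_linr _ _).
  exact: (comp_linear (outer_lin f 1) (lext_linear _)).
apply: (linear_eq (f := fun f => dd a (f * << g >>))
  (g := fun f => outer f (dd a << g >>) 1 + outer 1 (dd a f) << g >>)) => [||{}f].
- exact: (comp_linear (lext_linear _) (mulr_linear << g >>)).
- apply: add_linear; first exact: outer_linl.
  exact: (comp_linear (outer_lin 1 << g >>) (lext_linear _)).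
rewrite malgUM /dd !lextU /ddword splits_cat big_cat !big_map /= addrC !oneU.
rewrite !(linear_sum' _ _ _ (outer_lin _ _)).
by congr (_ + _); apply: eq_bigr => s _; rewrite outerU ?cats0.
Qed.

Lemma dd_uniq a D : double_derivation D ->
  (forall b, D (gen b) = dd a (gen b)) -> forall f, D f = dd a f.
Proof.
move=> [lD DM] Dg; have [_ dM] := ddP a.
have o1 : forall t : AA, outer << [::] >> t << [::] >> = t.
  apply: linear_eq => [||[p q]]; first exact: outer_lin.
    by [].
  by rewrite outerU cats0.
have nil0 (E : A -> AA) : (forall f g, E (f * g) = outer f (E g) 1 + outer 1 (E f) g)
    -> E << [::] >> = 0.
  move=> EM; have := EM << [::] >> << [::] >>; rewrite malgUM /= !oneU !o1.
  by rewrite -[LHS]addr0 => /addrI.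
apply: (linear_eq lD (lext_linear _)) => w.
elim: w => [|b w IH]; first by rewrite nil0 // -[RHS]/(dd a _) nil0.
by rewrite -cat1s -malgUM -[RHS]/(dd a _) DM dM Dg IH.
Qed.

Definition Acyc := quot_span commutator.
Definition Tcyc := quot_span supercommutator.
Definition clsA (f : A) : Acyc := cls commutator f.
Definition clsT (f : T) : Tcyc := cls supercommutator f.

Definition double_poisson (P : T) : Prop :=
  homog 2 P /\ clsT (bracket P P) = 0.

(* {P, -} on T/[T,T] and its precomposition with A/[A,A] -> T/[T,T];         *)
(* computed on representatives, see [dP_cls], [cycT_cls] and [d0_cls].       *)
Definition dP (P : T) (q : Tcyc) : Tcyc := clsT (bracket P (rep q)).
Definition cycT (q : Acyc) : Tcyc := clsT (inclT (rep q)).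
Definition d0 (P : T) (q : Acyc) : Tcyc := dP P (cycT q).
Definition H0 (P : T) : {pred Acyc} := [pred q | d0 P q == 0].

Lemma homog0 d : homog d 0.
Proof. by move=> w; rewrite msupp0 inE. Qed.

Lemma homogD d u v : homog d u -> homog d v -> homog d (u + v).
Proof.
move=> hu hv w /(fsubsetP (msuppD_le _ _)); rewrite inE => /orP[/hu|/hv] //.
Qed.

Lemma homogZ d c u : homog d u -> homog d (c *: u).
Proof. by move=> hu w /(fsubsetP (msuppZ_le _ _)) /hu. Qed.

Lemma homog_sum d (I : Type) (r : seq I) (P : pred I) (F : I -> T) :
  (forall i, P i -> homog d (F i)) -> homog d (\sum_(i <- r | P i) F i).
Proof.
move=> h; apply: (big_ind (homog d)) => //; [exact: homog0 | exact: homogD].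
Qed.

Lemma homog_bracket p m u v :
  homog p.+1 u -> homog m v -> homog (p + m) (bracket u v).
Proof.
move=> hu hv; rewrite /bracket /schouten lextE (linear_sum' _ _ _ (@tmul_linear _)).
rewrite big_seq; apply: homog_sum => k /hu ku.
rewrite (linearZ' _ _ (@tmul_linear _)) lextE (linear_sum' _ _ _ (@tmul_linear _)).
apply: homogZ; rewrite big_seq; apply: homog_sum => l /hv lv.
rewrite (linearZ' _ _ (@tmul_linear _)) (linear_sum' _ _ _ (@tmul_linear _)).
apply: homogZ; rewrite big_seq; apply: homog_sum => s /splitsP kE.
rewrite (linear_sum' _ _ _ (@tmul_linear _)) big_seq.
apply: homog_sum => t /splitsP lE.
rewrite (linearZ' _ _ (@tmul_linear _)) /tmul lextU /=.
have [d|] := boolP (deg1 s.1.2 + deg1 t.1.2 == 1)%N; last first.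
  by case: s.1.2 t.1.2 => a [] b //= _; rewrite mulr0 scale0r; apply: homog0.
apply: homogZ; suff <- : deg ((t.1.1 ++ s.2) ++ s.1.1 ++ t.2) = (p + m)%N.
  exact: homogU.
apply: succn_inj; rewrite -addSn -ku -lv kE lE !deg_cat !deg_cons.
rewrite -[in LHS]addn1 -(eqP d).
by rewrite [LHS](AC (2*2*2) (3*(5*2)*(1*(6*4)))).
Qed.

Lemma tmul_outer f t g : tmul (outer f t g) = f * tmul t * g :> T.
Proof.
apply: (linear_eq (f := fun t => tmul (outer f t g))
  (g := fun t => f * tmul t * g)) => [||[p q]].
- exact: (comp_linear (@tmul_linear _) (outer_lin _ _)).
- apply: (comp_linear (mulr_linear g)).
  exact: (comp_linear (mull_linear f) (@tmul_linear _)).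
apply: (linear_eq (f := fun f => tmul (outer f << (p, q) >> g))
  (g := fun f => f * tmul << (p, q) >> * g)) => [||u].
- exact: (comp_linear (@tmul_linear _) (outer_linl _ _)).
- by move=> c a b; rewrite !mulrDl -!scalerAl.
apply: (linear_eq (f := fun g => tmul (outer << u >> << (p, q) >> g))
  (g := fun g => << u >> * tmul << (p, q) >> * g)) => [||v].
- exact: (comp_linear (@tmul_linear _) (outer_linr _ _)).
- exact: mull_linear.
by rewrite outerU /tmul !lextU !malgUM /= !catA.
Qed.

Lemma bracket_leibniz m n u v w : homog m u -> homog n v ->
  bracket u (v * w) =
    (-1) ^+ (m.+1 * n) *: (v * bracket u w) + bracket u v * w.
Proof.
move=> hu hv; rewrite /bracket (schouten_leibniz _ hu hv) tmul_linear.
apply: (f_equal2 (fun a b => _ *: a + b)); first by rewrite tmul_outer mulr1.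
by rewrite tmul_outer mul1r.
Qed.

Lemma bracket_linear u : linear (bracket u).
Proof. exact: (comp_linear (@tmul_linear _) (schouten_linr u)). Qed.

Lemma supercommutator_sign (V : lmodType C) (p m n : nat) (x y z w : V) :
  ((-1) ^+ (p.+2 * m) *: z + w)
    - (-1) ^+ (m * n) *: ((-1) ^+ (p.+2 * n) *: x + y)
  = (-1) ^+ (p.+2 * m) *: (z - (-1) ^+ (m * (p + n)) *: y)
    + (w - (-1) ^+ ((p + m) * n) *: x).
Proof.
rewrite scalerDr scalerBr !scalerA -!exprD opprD.
rewrite [- _ - _]addrC addrACA; congr (_ - _ *: _ + (_ - _ *: _));
  apply: eq_sign; rewrite !(oddD, oddM, oddS) negbK;
  by case: (odd m) (odd n) (odd p) => [] [] [].
Qed.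

Lemma bracket_supercommutator p P f : homog p.+1 P -> supercommutator f ->
  bracket P f \in span supercommutator.
Proof.
move=> hP [m [n [u [v [hu hv ->]]]]].
have -> : bracket P (u * v - (-1) ^+ (m * n) *: (v * u)) =
    bracket P (u * v) - (-1) ^+ (m * n) *: bracket P (v * u).
  by rewrite [in LHS]addrC -scaleNr bracket_linear scaleNr addrC.
rewrite (bracket_leibniz _ hP hu) (bracket_leibniz _ hP hv).
set pu := bracket P u; set pv := bracket P v.
have hpu : homog (p + m) pu by exact: homog_bracket.
have hpv : homog (p + n) pv by exact: homog_bracket.
rewrite supercommutator_sign rpredD ?rpredZ //; apply: span_gen.
  by exists m, (p + n)%N, u, pv.
by exists (p + m)%N, n, pu, v.
Qed.

Lemma span_linear (U V : lmodType C) (S : U -> Prop) (S' : V -> Prop)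
  (f : U -> V) : linear f -> (forall s, S s -> f s \in span S') ->
  {homo f : u / u \in span S >-> u \in span S'}.
Proof.
move=> lf fS u /spanP; elim=> [|c s v /fS fs _ IH].
  by rewrite linear0' // rpred0.
by rewrite lf rpredD // rpredZ.
Qed.

Lemma dP_cls p P f : homog p.+1 P ->
  dP P (clsT f) = clsT (bracket P f).
Proof.
move=> hP; apply/eqP; rewrite cls_eqE.
have lB := bracket_linear P.
have -> g h : bracket P g - bracket P h = bracket P (g - h).
  by rewrite addrC -scaleN1r -lB scaleN1r addrC.
apply: (span_linear lB) => [s|]; first exact: (bracket_supercommutator hP).
by rewrite -cls_eqE; apply/eqP; exact: repK.
Qed.

Lemma inclT_linear : linear inclT. Proof. exact: lext_linear. Qed.

Lemma inclTM : {morph inclT : f g / f * g}.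
Proof.
move=> f g.
apply: (linear_eq (f := fun f => inclT (f * g))
  (g := fun f => inclT f * inclT g)) => [||u].
- exact: (comp_linear inclT_linear (mulr_linear g)).
- exact: (comp_linear (mulr_linear _) inclT_linear).
apply: (linear_eq (f := fun g => inclT (<< u >> * g))
  (g := fun g => inclT << u >> * inclT g)) => [||v].
- exact: (comp_linear inclT_linear (mull_linear _)).
- exact: (comp_linear (mull_linear _) inclT_linear).
by rewrite malgUM /inclT !lextU malgUM map_cat.
Qed.

Lemma homog_inclT f : homog 0 (inclT f).
Proof.
rewrite /inclT lextE; apply: homog_sum => w _; apply: homogZ.
suff {1}<- : deg (map Coord w) = 0%N by exact: homogU.
by elim: w => [|a w IH] /=; rewrite ?deg_nil ?deg_cons.
Qed.

Lemma inclT_commutator f : commutator f -> inclT f \in span supercommutator.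
Proof.
move=> [u [v ->]]; apply: span_gen; exists 0%N, 0%N, (inclT u), (inclT v).
split; [exact: homog_inclT..|].
rewrite scale1r -!inclTM -[_ - v * u]addrC -scaleN1r inclT_linear.
by rewrite scaleN1r addrC.
Qed.

Lemma cycT_cls f : cycT (clsA f) = clsT (inclT f).
Proof.
apply/eqP; rewrite cls_eqE.
have -> g h : inclT g - inclT h = inclT (g - h).
  by rewrite addrC -scaleN1r -inclT_linear scaleN1r addrC.
apply: (span_linear inclT_linear inclT_commutator).
by rewrite -cls_eqE; apply/eqP; exact: repK.
Qed.

Lemma d0_cls p P f : homog p.+1 P ->
  d0 P (clsA f) = clsT (bracket P (inclT f)).
Proof. by move=> hP; rewrite /d0 cycT_cls (dP_cls _ hP). Qed.

Lemma homogM m n u v : homog m u -> homog n v -> homog (m + n) (u * v).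
Proof.
by move=> hu hv w /msuppM_le [a [b [/hu <- /hv <- ->]]]; rewrite -deg_cat.
Qed.

Lemma homog_P1 : homog 2 P1.
Proof.
have hc a : homog 0 (coord a).
  by have := homogU [:: Coord a]; rewrite deg_cons deg_nil.
have hd a : homog 1 (der a).
  by have := homogU [:: Der a]; rewrite deg_cons deg_nil.
apply: homogD; first exact: (homogM (homogM (hc X) (hd X)) (hd X)).
exact: (homogM (homogM (hc Y) (hd X)) (hd Y)).
Qed.

Lemma bracketU u v : bracket << u >> << v >> = tmul (schouten_word u v).
Proof. by rewrite /bracket schoutenU. Qed.

Lemma P1E : P1 = << [:: Coord X; Der X; Der X] >> + << [:: Coord Y; Der X; Der Y] >>.
Proof. by apply: f_equal2; rewrite /coord /der !malgUM. Qed.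

Lemma bracketD u v w : bracket u (v + w) = bracket u v + bracket u w.
Proof. by rewrite -[v in LHS]scale1r bracket_linear scale1r. Qed.

Lemma bracketDl u v w : bracket (u + v) w = bracket u w + bracket v w.
Proof.
rewrite /bracket -[u in LHS]scale1r schouten_linl tmul_linear.
by rewrite !scale1r.
Qed.


Lemma P1_terms (V : lmodType C) (B : seq letter -> V) :
  let F (u v : seq letter) := \sum_(s <- splits u) \sum_(t <- splits v)
      ((-1) ^+ ((deg u).+1 * deg t.1.1 + (deg s.1.1 + deg1 s.1.2) * deg s.2)
        * letter_bracket s.1.2 t.1.2) *: B ((t.1.1 ++ s.2) ++ s.1.1 ++ t.2) in
  let p := [:: Coord X; Der X; Der X] in let q := [:: Coord Y; Der X; Der Y] in
  F p p + F p q + (F q p + F q q) =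
  (B (p ++ [:: Der X]) - B (Der X :: p))
  + (B [:: Coord Y; Der X; Der X; Der Y] - B [:: Der Y; Coord Y; Der X; Der X]).
Proof.
move=> F p q.
have d3 a b c : deg [:: Coord a; Der b; Der c] = 2%N.
  by rewrite !deg_cons deg_nil.
have d2 a b : deg [:: a; b] = (deg1 a + deg1 b)%N.
  by rewrite !deg_cons deg_nil addn0.
have d1 a : deg [:: a] = deg1 a by rewrite !deg_cons deg_nil addn0.
have e n : (-1) ^+ n.+2 = (-1) ^+ n :> C.
  by rewrite !exprS mulrA mulrNN !mul1r.
rewrite /F /= !big_cons !big_nil /= !d3 !d2 !d1 !deg_nil /=.
rewrite !(mulr0, scale0r, mul0n, muln0, mul1n, muln1, addn0, add0n, add1n, addn1,
  e, expr0, expr1, mulN1r, mulr1, mul1r, opprK, oppr0, scale1r, scaleN1r, addr0, add0r).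
rewrite addNr add0r [- B _ + B _]addrC -addrA; congr (_ + _).
by rewrite addrCA addKr addrC.
Qed.

Lemma P1_double_poisson : double_poisson P1.
Proof.
split; first exact: homog_P1.
have lt : linear (@tmul C letter) by exact: lext_linear.
have E u v : bracket << u >> << v >> =
    \sum_(s <- splits u) \sum_(t <- splits v)
      ((-1) ^+ ((deg u).+1 * deg t.1.1 + (deg s.1.1 + deg1 s.1.2) * deg s.2)
        * letter_bracket s.1.2 t.1.2) *: << (t.1.1 ++ s.2) ++ s.1.1 ++ t.2 >>.
  rewrite bracketU /schouten_word (linear_sum' _ _ _ lt).
  apply: eq_bigr => s _; rewrite (linear_sum' _ _ _ lt).
  apply: eq_bigr => t _; rewrite (linearZ' _ _ lt); congr (_ *: _).
  by rewrite /tmul lextU.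
apply/eqP; rewrite -[0](linear0' (@cls_linear _ _ _)) /clsT cls_eqE subr0.
have D (a b : T) : bracket (a + b) (a + b) =
    bracket a a + bracket a b + (bracket b a + bracket b b).
  by rewrite bracketDl !bracketD.
have -> := etrans (congr1 (fun P => bracket P P) P1E) (D _ _).
have -> := etrans (f_equal2 +%R (f_equal2 +%R (E _ _) (E _ _))
  (f_equal2 +%R (E _ _) (E _ _))) (P1_terms (fun w => << w >> : T)).
have e2 : (-1) ^+ (2 * 1) = 1 :> C by rewrite muln1 expr2 mulrNN mul1r.
rewrite rpredD //; apply: span_gen.
  exists 2%N, 1%N, << [:: Coord X; Der X; Der X] >>, << [:: Der X] >>.
  split; last by rewrite e2 scale1r !malgUM.
    by have := homogU [:: Coord X; Der X; Der X]; rewrite !deg_cons deg_nil.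
  by have := homogU [:: Der X]; rewrite !deg_cons deg_nil.
exists 2%N, 1%N, << [:: Coord Y; Der X; Der X] >>, << [:: Der Y] >>.
split; last by rewrite e2 scale1r !malgUM.
  by have := homogU [:: Coord Y; Der X; Der X]; rewrite !deg_cons deg_nil.
by have := homogU [:: Der Y]; rewrite !deg_cons deg_nil.
Qed.

Definition projT (f : T) : A :=
  lext (fun w => if deg w == 0%N
                 then << pmap (fun l => if l is Coord a then Some a else None) w >>
                 else 0) f.

Lemma projT_linear : linear projT. Proof. exact: lext_linear. Qed.

Lemma projTM : {morph projT : f g / f * g}.
Proof.
move=> f g.
apply: (linear_eq (f := fun f => projT (f * g))
  (g := fun f => projT f * projT g)) => [||u].
- exact: (comp_linear projT_linear (mulr_linear g)).
- exact: (comp_linear (mulr_linear _) projT_linear).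
apply: (linear_eq (f := fun g => projT (<< u >> * g))
  (g := fun g => projT << u >> * projT g)) => [||v].
- exact: (comp_linear projT_linear (mull_linear _)).
- exact: (comp_linear (mull_linear _) projT_linear).
rewrite malgUM /projT !lextU deg_cat addn_eq0.
case: (deg u == 0%N); case: (deg v == 0%N) => /=; rewrite ?mul0r ?mulr0 //.
by rewrite malgUM pmap_cat.
Qed.

Lemma inclTK : cancel inclT projT.
Proof.
apply: (linear_eq (f := fun f => projT (inclT f)) (g := id)) => [||w] //.
  exact: (comp_linear projT_linear inclT_linear).
rewrite /inclT /projT !lextU.
have -> : deg (map Coord w) = 0%N.
  by elim: w => [|a w IH] /=; rewrite ?deg_nil ?deg_cons.
by congr << _ >>; elim: w => //= a w ->.
Qed.

Lemma projT_supercommutator f :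
  supercommutator f -> projT f \in span commutator.
Proof.
move=> [m [n [u [v [hu hv ->]]]]].
have -> : projT (u * v - (-1) ^+ (m * n) *: (v * u)) =
    projT u * projT v - (-1) ^+ (m * n) *: (projT v * projT u).
  by rewrite [in LHS]addrC -scaleNr projT_linear scaleNr addrC !projTM.
case: m hu => [|m] hu.
  by apply: span_gen; exists (projT u), (projT v); rewrite scale1r.
have -> : projT u = 0.
  apply: (linear_eq_on (f := projT) (g := fun=> 0)) => [||w /hu wm].
  - exact: projT_linear.
  - by move=> c x y; rewrite scaler0 addr0.
  by rewrite /projT lextU wm.
by rewrite mul0r mulr0 scaler0 subr0 rpred0.
Qed.

(* A/[A,A] is the degree 0 part of T/[T,T] *)
Lemma cycT_inj : injective cycT.
Proof.
move=> p q; rewrite -[p]repK -[q]repK -!/(clsA _) !cycT_cls => /eqP.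
rewrite /clsT cls_eqE => /(span_linear projT_linear projT_supercommutator).
have -> (f g : A) : projT (inclT f - inclT g) = f - g.
  by rewrite addrC -scaleN1r projT_linear !inclTK scaleN1r addrC.
by rewrite -cls_eqE => /eqP.
Qed.

End FreeAlgebras.

Arguments homogU {C} w x _.

(* Main.v *)
Require Import Defs.
From HB Require Import structures.
From mathcomp Require Import all_boot all_order all_algebra.
From mathcomp Require Import finmap monalg boolp.

Import GRing.Theory.
Local Open Scope ring_scope.

Set Implicit Arguments.
Unset Strict Implicit.
Unset Printing Implicit Defensive.

(** Write D_a f for the cyclic derivative (df/da)''(df/da)' of f.

    The bracket of a bivector x_a d_b d_c with a word f is a sum over the
    positions of f carrying the letter c or b.  Modulo supercommutators words
    of T can be rotated past a factor of degree 0, so that in every summand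
    the surviving derivation moves to the right end; this gives
      {x_a d_b d_c, f} = (D_c f) x_a d_b - x_a (D_b f) d_c
    ([clsT_bracket_bivector]).  For P1 the coefficient of d/dx is thus
    (D_x f) x - x (D_x f) + (D_y f) y, and it equals y (D_y f) because
    [x, D_x f] + [y, D_y f] = 0 ([cderiv_commutators]): on a word both
    x (D_x f) + y (D_y f) and (D_x f) x + (D_y f) y list all its rotations.

    For the cohomology, the coefficients of d/dx and d/dy of a class of degree
    one are well defined elements of A ([der_coef_cls]), so a class killed by
    d0 satisfies y (D_y f) = y (D_x f) = 0, whence D_x f = D_y f = 0
    ([cderiv_of_d0_P1_eq0]).  Now x (D_x f) + y (D_y f) is, on a word of
    length n, the sum of its n rotations, which is n times the word modulo
    commutators ([cyclic_euler]).  In characteristic 0 one can divide by n for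
    each nonempty word, and f is congruent to its constant term
    ([clsA_of_cderiv_eq0]).  The constant term of a commutator vanishes, so
    distinct constants have distinct classes. *)

(* Unification must not compute with coefficients of polynomials. *)
Local Opaque lext.

(** * Unbundled linear maps *)

Section UnbundledLinear.
Variables (C : comNzRingType) (U V : lmodType C).
Implicit Types h k : U -> V.

Lemma linearB' h x y : linear h -> h (x - y) = h x - h y.
Proof. by move=> lh; rewrite addrC -scaleN1r lh scaleN1r addrC. Qed.

Lemma linearD' h x y : linear h -> h (x + y) = h x + h y.
Proof. by move=> lh; rewrite -[x in LHS]scale1r lh scale1r. Qed.

Lemma sub_linear h k :
  linear h -> linear k -> linear (fun x => h x - k x).
Proof. by move=> lh lk c x y; rewrite lh lk scalerBr opprD addrACA. Qed.

Lemma span_linear0 h (S : U -> Prop) u :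
  linear h -> (forall s, S s -> h s = 0) -> u \in Defs.span S -> h u = 0.
Proof.
move=> lh hS /Defs.spanP; elim=> [|c s v /hS hs _ IH]; first exact: linear0'.
by rewrite lh hs IH scaler0 addr0.
Qed.

End UnbundledLinear.

Lemma addrBB_swap (V : zmodType) (p q r s t : V) :
  q + s = p + r -> (p - q) + (r - t) = s - t.
Proof. by move=> e; rewrite addrACA -e addrACA subrr add0r. Qed.

(** * Rotations of words *)

Section Splits.
Context {L : Type}.
Implicit Type w : seq L.

Lemma size_splits w : size (splits w) = size w.
Proof. by elim: w => //= a w IH; rewrite size_map IH. Qed.

Lemma splits_map (L' : Type) (h : L -> L') w :
  splits (map h w) = [seq (map h s.1.1, h s.1.2, map h s.2) | s <- splits w].
Proof. by elim: w => //= a w ->; rewrite -!map_comp. Qed.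

(** Moving the cut of [w] across one letter is one step of the sum; going from
    the cut before [w] to the cut after [w], the two sums share all the
    intermediate cuts. *)
Lemma splits_telescope (V : zmodType) (G : seq L -> seq L -> V) w :
  \sum_(s <- splits w) G (rcons s.1.1 s.1.2) s.2 + G [::] w
  = \sum_(s <- splits w) G s.1.1 (s.1.2 :: s.2) + G w [::].
Proof.
elim: w G => [|a w IH] G /=; first by rewrite !big_nil.
rewrite !big_cons !big_map /= -[RHS]addrA.
by rewrite -(IH (fun p q => G (a :: p) q)) [RHS]addrC [_ + G [:: a] w]addrC.
Qed.

(** The left side omits the trivial rotation at the start of the word, the
    right side the one at its end: both are [F w]. *)
Lemma sum_rotations (V : zmodType) (F : seq L -> V) w :
  \sum_(s <- splits w) F (s.2 ++ rcons s.1.1 s.1.2)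
  = \sum_(s <- splits w) F (s.1.2 :: s.2 ++ s.1.1).
Proof.
have := splits_telescope (fun p q => F (q ++ p)) w.
by rewrite cats0 => /addIr.
Qed.
End Splits.

(** * Cyclic derivatives *)

Section CyclicDerivative.
Variable C : comNzRingType.
Local Notation A := (freeA C).
Implicit Types (a b c : var) (f g : A).

Definition cderiv a f : A := tmul_op (dd a f).

Lemma cderiv_linear a : linear (cderiv a).
Proof.
by apply: (comp_linear (f := @tmul_op C var)); apply: lext_linear.
Qed.

Lemma cderivU a w :
  cderiv a << w >> = \sum_(s <- splits w | s.1.2 == a) << s.2 ++ s.1.1 >>.
Proof.
have lt : linear (@tmul_op C var) by exact: lext_linear.
rewrite /cderiv /dd lextU /ddword (linear_sum' _ _ _ lt).
by apply: eq_bigr => s _; rewrite /tmul_op lextU.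
Qed.

Lemma cderiv1 a : cderiv a 1 = 0.
Proof. by rewrite oneU cderivU big_nil. Qed.

Lemma big_var (V : zmodType) (r : seq (seq var * var * seq var)) (F : _ -> V) :
  \sum_(s <- r | s.1.2 == X) F s + \sum_(s <- r | s.1.2 == Y) F s
  = \sum_(s <- r) F s.
Proof.
rewrite [RHS](bigID (fun s => s.1.2 == X)) /=; congr (_ + _).
by apply: eq_bigl => -[[p []] q].
Qed.

Lemma gen_cderivU a w : gen C a * cderiv a << w >>
  = \sum_(s <- splits w | s.1.2 == a) << s.1.2 :: s.2 ++ s.1.1 >>.
Proof.
rewrite cderivU mulr_sumr; apply: eq_bigr => s /eqP ->.
by rewrite malgUM.
Qed.

Lemma cderivU_gen a w : cderiv a << w >> * gen C a
  = \sum_(s <- splits w | s.1.2 == a) << s.2 ++ rcons s.1.1 s.1.2 >>.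
Proof.
rewrite cderivU mulr_suml; apply: eq_bigr => s /eqP ->.
by rewrite malgUM -catA cats1.
Qed.

Local Opaque cderiv gen.

(** On a word, x_a (D_a w) and (D_a w) x_a both run over the rotations of w that
    cut it next to an occurrence of a, before it and after it respectively;
    summing over all letters gives every rotation once on each side. *)
Lemma cderiv_commutators f :
  gen C X * cderiv X f + gen C Y * cderiv Y f
  = cderiv X f * gen C X + cderiv Y f * gen C Y.
Proof.
pose l a := comp_linear (mull_linear (gen C a)) (cderiv_linear a).
pose r a := comp_linear (mulr_linear (gen C a)) (cderiv_linear a).
apply: (linear_eq (add_linear (l X) (l Y)) (add_linear (r X) (r Y))) => w.
rewrite -[LHS]/(gen C X * cderiv X << w >> + gen C Y * cderiv Y << w >>).
rewrite -[RHS]/(cderiv X << w >> * gen C X + cderiv Y << w >> * gen C Y).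
rewrite (f_equal2 +%R (gen_cderivU X w) (gen_cderivU Y w)).
rewrite (f_equal2 +%R (cderivU_gen X w) (cderivU_gen Y w)).
rewrite !big_var.
exact: (esym (sum_rotations (fun v => << v >>) w)).
Qed.

Lemma clsA_linear : linear (@clsA C).
Proof. exact: cls_linear. Qed.

Lemma clsA_cyc u v : clsA << u ++ v >> = clsA << v ++ u >> :> Acyc C.
Proof.
apply/eqP; rewrite cls_eqE; apply: span_gen.
by exists << u >>, << v >>; rewrite !malgUM.
Qed.

(** Euler's identity: the left side is the sum of all the rotations of [w], and
    a rotation does not change the class modulo commutators. *)
Lemma cyclic_euler w :
  clsA (gen C X * cderiv X << w >> + gen C Y * cderiv Y << w >>)
  = (size w)%:R *: clsA << w >>.
Proof.
rewrite (gen_cderivU X) (gen_cderivU Y) big_var (linear_sum' _ _ _ clsA_linear).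
rewrite (eq_big_seq (fun _ => clsA << w >>)) => [|s /splitsP wE]; last first.
  by rewrite -cat_cons clsA_cyc -wE.
by rewrite big_const_seq count_predT size_splits iter_addr addr0 scaler_nat.
Qed.

(** * Brackets of bivectors with functions *)

Lemma clsT_linear : linear (@clsT C).
Proof. exact: cls_linear. Qed.

(** When the moved factor has degree 0 the supercommutator carries no sign. *)
Lemma clsT_cyc u v : deg u = 0%N ->
  clsT << u ++ v >> = clsT << v ++ u >> :> Tcyc C.
Proof.
move=> u0; apply/eqP; rewrite cls_eqE; apply: span_gen.
exists (deg u), (deg v), << u >>, << v >>; split; [exact: homogU..|].
by rewrite u0 mul0n scale1r !malgUM.
Qed.

Lemma deg_map_Coord w : deg (map Coord w) = 0%N.
Proof. by elim: w => [|a w IH] /=; rewrite ?deg_nil ?deg_cons. Qed.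

Lemma inclTU w : inclT << w >> = << map Coord w >> :> freeT C.
Proof. by rewrite /inclT lextU. Qed.

(** The sign simplifies because all the letters of [w] have degree 0. *)
Lemma bracket_coords u w :
  bracket << u >> (inclT << w >>)
  = \sum_(s <- splits u) \sum_(t <- splits w)
      ((-1) ^+ ((deg s.1.1 + deg1 s.1.2) * deg s.2)
         * letter_bracket C s.1.2 (Coord t.1.2))
      *: << map Coord t.1.1 ++ s.2 ++ s.1.1 ++ map Coord t.2 >> :> freeT C.
Proof.
have lt := @tmul_linear C letter.
rewrite inclTU bracketU /schouten_word (linear_sum' _ _ _ lt).
apply: eq_bigr => s _; rewrite splits_map big_map (linear_sum' _ _ _ lt).
apply: eq_bigr => t _; rewrite (linearZ' _ _ lt) deg_map_Coord muln0 add0n.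
by rewrite /tmul lextU /= -!catA.
Qed.

Lemma sum_letter_bracket (V : lmodType C) k b w (F : _ -> V) :
  \sum_(t <- splits w) (k * letter_bracket C (Der b) (Coord t.1.2)) *: F t
  = k *: \sum_(t <- splits w | t.1.2 == b) F t.
Proof.
rewrite scaler_sum' [RHS]big_mkcond; apply: eq_bigr => t _ /=.
by rewrite eq_sym; case: eqP; rewrite ?mulr1 ?mulr0 ?scale0r.
Qed.

(** The letter [Coord a] does not meet the coordinates of [w]; the sign comes
    from [Der b] jumping over [Der c]. *)
Lemma bracket_bivector_word a b c w :
  bracket << [:: Coord a; Der b; Der c] >> (inclT << w >>)
  = \sum_(t <- splits w | t.1.2 == c)
      << map Coord t.1.1 ++ [:: Coord a; Der b] ++ map Coord t.2 >>
    - \sum_(t <- splits w | t.1.2 == b)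
        << map Coord t.1.1 ++ [:: Der c; Coord a] ++ map Coord t.2 >>
  :> freeT C.
Proof.
rewrite bracket_coords !big_cons big_nil addr0 /=.
rewrite !(deg_cons, deg_nil) /= ?(addn0, add0n, muln0, expr0, muln1).
rewrite (eq_bigr (fun=> 0)) => [|t _]; last by rewrite mulr0 scale0r.
by rewrite big1_eq add0r addrC !sum_letter_bracket expr1 scale1r scaleN1r.
Qed.

Lemma inclT_der_linear b : linear (fun g : A => inclT g * der C b).
Proof. exact: (comp_linear (mulr_linear _) (@inclT_linear C)). Qed.

Lemma inclTU_der b w : inclT << w >> * der C b = << map Coord w ++ [:: Der b] >>.
Proof. by rewrite inclTU malgUM. Qed.

(** The next two lemmas rotate the derivation of each term of
    [bracket_bivector_word] to the right end of the word. *)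
Lemma clsT_gen_der (a b c : var) w :
  clsT (inclT (cderiv c << w >> * gen C a) * der C b)
  = \sum_(t <- splits w | t.1.2 == c)
      clsT << map Coord t.1.1 ++ [:: Coord a; Der b] ++ map Coord t.2 >>.
Proof.
pose h g := clsT (inclT (g * gen C a) * der C b).
have lh : linear h.
  exact: (comp_linear clsT_linear
    (comp_linear (inclT_der_linear b) (mulr_linear _))).
apply: (etrans (congr1 h (cderivU c w))); rewrite (linear_sum' _ _ _ lh).
apply: eq_bigr => t _; rewrite /h malgUM inclTU_der 2!map_cat -!catA.
by rewrite [LHS]clsT_cyc ?deg_map_Coord // -!catA.
Qed.

Lemma clsT_der_gen (a b c : var) w :
  clsT (inclT (gen C a * cderiv b << w >>) * der C c)
  = \sum_(t <- splits w | t.1.2 == b)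
      clsT << map Coord t.1.1 ++ [:: Der c; Coord a] ++ map Coord t.2 >>.
Proof.
pose h g := clsT (inclT (gen C a * g) * der C c).
have lh : linear h.
  exact: (comp_linear clsT_linear
    (comp_linear (inclT_der_linear c) (mull_linear _))).
apply: (etrans (congr1 h (cderivU b w))); rewrite (linear_sum' _ _ _ lh).
apply: eq_bigr => t _; rewrite /h malgUM inclTU_der catA map_cat -!catA.
by rewrite [LHS]clsT_cyc ?deg_map_Coord // -!catA.
Qed.

Lemma clsT_bracket_bivector a b c f :
  clsT (bracket << [:: Coord a; Der b; Der c] >> (inclT f))
  = clsT (inclT (cderiv c f * gen C a) * der C b
          - inclT (gen C a * cderiv b f) * der C c).
Proof.
pose p := << [:: Coord a; Der b; Der c] >> : freeT C.
have ll : linear (fun f => clsT (bracket p (inclT f))).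
  exact: (comp_linear (comp_linear clsT_linear (bracket_linear p))
    (@inclT_linear C)).
have lr : linear (fun f => clsT (inclT (cderiv c f * gen C a) * der C b
          - inclT (gen C a * cderiv b f) * der C c)).
  apply: (comp_linear clsT_linear); apply: sub_linear.
    exact: (comp_linear (inclT_der_linear b)
      (comp_linear (mulr_linear _) (cderiv_linear c))).
  exact: (comp_linear (inclT_der_linear c)
    (comp_linear (mull_linear _) (cderiv_linear b))).
apply: (linear_eq ll lr) => {ll lr f} w.
apply: (etrans (congr1 (@clsT C) (bracket_bivector_word a b c w))).
apply: (etrans (linearB' _ _ clsT_linear)).
apply: (etrans _ (esym (linearB' _ _ clsT_linear))).
apply: (f_equal2 (fun x y => x - y)).
  exact: etrans (linear_sum' _ _ _ clsT_linear) (esym (clsT_gen_der _ _ _ _)).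
exact: etrans (linear_sum' _ _ _ clsT_linear) (esym (clsT_der_gen _ _ _ _)).
Qed.

Lemma d0_P1 f : d0 (P1 C) (clsA f)
  = clsT (inclT (gen C Y * cderiv Y f) * der C X
          - inclT (gen C Y * cderiv X f) * der C Y).
Proof.
rewrite (d0_cls _ (@homog_P1 C)) P1E bracketDl.
apply: (etrans (linearD' _ _ clsT_linear)).
apply: (etrans (f_equal2 +%R (clsT_bracket_bivector X X X f)
  (clsT_bracket_bivector Y X Y f))).
apply: (etrans (esym (linearD' _ _ clsT_linear))).
pose h g := inclT g * der C X; have lh : linear h by exact: inclT_der_linear.
have e : h (gen C X * cderiv X f) + h (gen C Y * cderiv Y f)
    = h (cderiv X f * gen C X) + h (cderiv Y f * gen C Y).
  apply: (etrans (esym (linearD' _ _ lh))).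
  exact: (etrans (congr1 h (cderiv_commutators f)) (linearD' _ _ lh)).
apply: (congr1 (@clsT C)).
exact: addrBB_swap e.
Qed.

(** * Coefficients of the derivations *)

(** The coefficient of d/da in a word p d_a q of degree 1 is the rotation q p;
    [projT] discards the occurrences of d_a in words of higher degree. *)
Definition der_coef_word a (v : seq letter) : A :=
  \sum_(s <- splits v | s.1.2 == Der a) projT << s.2 ++ s.1.1 >>.
Definition der_coef a (u : freeT C) : A := lext (der_coef_word a) u.

Lemma der_coef_linear a : linear (der_coef a).
Proof. exact: lext_linear. Qed.

Lemma projT_deg v : deg v != 0%N -> projT << v >> = 0 :> A.
Proof. by rewrite /projT lextU => /negPf ->. Qed.

Lemma der_coef_word_cat a u v : der_coef_word a (u ++ v)
  = \sum_(s <- splits u | s.1.2 == Der a) projT << s.2 ++ v ++ s.1.1 >>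
    + \sum_(s <- splits v | s.1.2 == Der a) projT << s.2 ++ u ++ s.1.1 >>.
Proof.
rewrite /der_coef_word splits_cat big_cat !big_map.
apply: (f_equal2 +%R); apply: eq_bigr => s _ /=; first by rewrite -catA.
done.
Qed.

Lemma der_coef_word_deg a u : (1 < deg u)%N -> der_coef_word a u = 0.
Proof.
move=> u1; rewrite /der_coef_word big_seq_cond big1 //.
move=> s /andP[/splitsP uE /eqP sa].
rewrite projT_deg // deg_cat addnC -deg_cat; move: u1.
by rewrite uE !deg_cat deg_cons sa addnS ltnS lt0n.
Qed.

(** Rotating a word permutes the summands of [der_coef_word].  A sign can only
    occur when both factors have positive degree, but then the product has
    degree at least 2 and its coefficients vanish. *)
Lemma der_coef_supercommutator a u : supercommutator u -> der_coef a u = 0.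
Proof.
move=> [m [n [v [w [hv hw ->]]]]]; have lc := der_coef_linear a.
apply/eqP; rewrite (linearB' _ _ lc) (linearZ' _ _ lc) subr_eq0; apply/eqP.
apply: (linear_eq_on (f := fun v => der_coef a (v * w))
  (g := fun v => (-1) ^+ (m * n) *: der_coef a (w * v))) => [||v' /hv <-].
- exact: (comp_linear lc (mulr_linear w)).
- apply: scale_linear; exact: (comp_linear lc (mull_linear w)).
apply: (linear_eq_on (f := fun w => der_coef a (<< v' >> * w))
  (g := fun w => (-1) ^+ (deg v' * n) *: der_coef a (w * << v' >>)))
  => [||w' /hw <-].
- exact: (comp_linear lc (mull_linear << v' >>)).
- apply: scale_linear; exact: (comp_linear lc (mulr_linear << v' >>)).
rewrite !malgUM /der_coef !lextU.
have [d0|] := eqVneq (deg v' * deg w')%N 0%N.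
  by rewrite d0 scale1r !der_coef_word_cat addrC.
rewrite muln_eq0 negb_or -!lt0n => /andP[v0 w0].
have vw : (1 < deg v' + deg w')%N by rewrite -addn1 leq_add.
by rewrite !der_coef_word_deg ?scaler0 // deg_cat // addnC.
Qed.

Lemma der_coef_inclT a b g : der_coef a (inclT g * der C b) = (a == b)%:R *: g.
Proof.
apply: (linear_eq (f := fun g => der_coef a (inclT g * der C b))
  (g := fun g => (a == b)%:R *: g)) => [||w].
- exact: (comp_linear (der_coef_linear a) (inclT_der_linear b)).
- exact: scale_linear.
rewrite inclTU_der /der_coef lextU /der_coef_word splits_cat splits_map.
rewrite big_cat !big_map [X in X + _ = _]big_pred0 // add0r.
rewrite big_mkcond big_seq1 /= cats0.
rewrite -inclTU inclTK.
rewrite (_ : (Der b == Der a) = (a == b)); last by rewrite eq_sym.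
by case: eqP; rewrite ?scale1r ?scale0r.
Qed.

Lemma der_coef_cls a u v : clsT u = clsT v -> der_coef a u = der_coef a v.
Proof.
move=> /eqP; rewrite cls_eqE.
move=> /(span_linear0 (der_coef_linear a) (@der_coef_supercommutator a)).
by rewrite (linearB' _ _ (der_coef_linear a)) => /eqP; rewrite subr_eq0 => /eqP.
Qed.

(** Deleting the first letter of each word undoes left multiplication by a
    generator. *)
Lemma gen_mulI a : injective ( *%R (gen C a)).
Proof.
pose tl (w : seq var) : A := << behead w >>.
suff K : cancel ( *%R (gen C a)) (lext tl) by exact: can_inj K.
apply: (linear_eq (f := fun g => lext tl (gen C a * g)) (g := id)) => [||w] //.
  exact: (comp_linear (lext_linear tl) (mull_linear (gen C a))).
by rewrite malgUM lextU.
Qed.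

(** * The kernel of the differential *)

Lemma cderiv_of_d0_P1_eq0 f : d0 (P1 C) (clsA f) = 0 -> forall a, cderiv a f = 0.
Proof.
pose p := gen C Y * cderiv Y f; pose q := gen C Y * cderiv X f => df0.
have e : clsT (inclT p * der C X - inclT q * der C Y) = clsT 0.
  by apply: (etrans (esym (d0_P1 f))); rewrite df0 (linear0' clsT_linear).
have E a := der_coef_cls a e.
have {E} E a : (a == X)%:R *: p - (a == Y)%:R *: q = 0.
  rewrite -!der_coef_inclT -(linearB' _ _ (der_coef_linear a)) E.
  exact: linear0' (der_coef_linear a).
have p0 : p = 0 by have := E X; rewrite /= scale1r scale0r subr0.
have q0 : q = 0.
  by have := E Y; rewrite /= scale1r scale0r sub0r => /eqP; rewrite oppr_eq0 => /eqP.
have mul0 g : gen C Y * g = 0 -> g = 0.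
  by move=> g0; apply: (@gen_mulI Y); apply: (etrans g0); rewrite mulr0.
by case; [apply: (mul0 _ q0) | apply: (mul0 _ p0)].
Qed.

(** Valued in [C^o], so that it is a linear map between modules. *)
Definition const_coef f : C^o := f@_[::].

Lemma const_coef_linear : linear const_coef.
Proof. by move=> c f g; rewrite /const_coef mcoeffD mcoeffZ. Qed.

Lemma clsA_const_inj : injective (fun c : C => clsA (c%:A : A)).
Proof.
move=> c d /eqP; rewrite cls_eqE => /(span_linear0 const_coef_linear) e.
apply/eqP; rewrite -subr_eq0; apply/eqP.
have -> : c - d = const_coef (c%:A - d%:A).
  by rewrite (linearB' _ _ const_coef_linear) /const_coef !mcoeffZ !mcoeff1 !mulr1.
apply: e => _ [u [v ->]]; rewrite (linearB' _ _ const_coef_linear).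
by rewrite /const_coef !(rmorphM (@mcoeff (seq var) C [::])) /= mulrC subrr.
Qed.

Lemma H0_const (k : C) : clsA (k%:A : A) \in H0 (P1 C).
Proof.
have z a : cderiv a (k%:A : A) = 0.
  by rewrite (linearZ' _ _ (cderiv_linear a)) cderiv1 scaler0.
rewrite inE d0_P1 !z !mulr0 (linear0' (@inclT_linear C)) !mul0r subr0.
by rewrite (linear0' clsT_linear).
Qed.

End CyclicDerivative.

(** Divide the identity [cyclic_euler] by the length of each word; the empty
    word, of length 0, contributes the constant term. *)
Lemma clsA_of_cderiv_eq0 (F : fieldType) (f : freeA F) : [pchar F] =i pred0 ->
  (forall a, cderiv a f = 0) -> clsA f = clsA (f@_[::])%:A.
Proof.
move=> char0 f0.
pose N g := gen F X * cderiv X g + gen F Y * cderiv Y g.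
pose E (w : seq var) : freeA F := (size w)%:R^-1 *: << w >>.
have Nf : N f = 0 by rewrite /N !f0 !mulr0 addr0.
have lN : linear N.
  by apply: add_linear; exact: (comp_linear (mull_linear _) (cderiv_linear _)).
have lE := lext_linear E.
have lc : linear (fun g : freeA F => g - (g@_[::])%:A).
  apply: sub_linear => // c u v.
  by rewrite mcoeffD mcoeffZ scalerDl scalerA.
(* the rotations of a word, summed up by [N], all have its length *)
have K g : clsA (lext E (N g)) = clsA (g - (g@_[::])%:A).
  apply: (linear_eq (comp_linear (@clsA_linear F) (comp_linear lE lN))
    (comp_linear (@clsA_linear F) lc)) => w.
  rewrite -[LHS]/(clsA (lext E (N << w >>))).
  rewrite -[RHS]/(clsA (<< w >> - (<< w >>@_[::])%:A)).
  have -> : lext E (N << w >>) = (size w)%:R^-1 *: N << w >>.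
    rewrite /N gen_cderivU gen_cderivU big_var (linear_sum' _ _ _ lE) scaler_sum'.
    rewrite !big_seq; apply: eq_bigr => s /splitsP wE; rewrite lextU /E.
    by rewrite wE /= !size_cat /= addnS addnC.
  rewrite (linearZ' _ _ (@clsA_linear F)) cyclic_euler scalerA mcoeffU.
  have [->|w0] := eqVneq w [::].
    by rewrite /= mulr0 scale0r scale1r oneU subrr (linear0' (@clsA_linear F)).
  rewrite mulVf ?scale1r ?scale0r ?subr0 //.
  by rewrite (pcharf0P _).1 // size_eq0.
have := K f; rewrite Nf (linear0' lE) (linear0' (@clsA_linear F)).
by rewrite (linearB' _ _ (@clsA_linear F)) => /esym/eqP; rewrite subr_eq0 => /eqP.
Qed.

Theorem proposition17 (C : closedFieldType) (charC : [pchar C] =i pred0) :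
  (forall f : freeA C,
     d0 (P1 C) (clsA f) =
     clsT (inclT (gen C Y * tmul_op (dd Y f)) * der C X
           - inclT (gen C Y * tmul_op (dd X f)) * der C Y)) /\
  (injective (fun c : C => clsA (c%:A)) /\
   forall q : Acyc C, q \in H0 (P1 C) <-> exists c : C, q = clsA (c%:A)).
Proof.
split; first exact: d0_P1.
split=> [|q]; first exact: clsA_const_inj.
split=> [|[c ->]]; last exact: H0_const.
rewrite -[q]repK -/(clsA _) inE.
move=> /eqP/cderiv_of_d0_P1_eq0/(clsA_of_cderiv_eq0 charC) ->.
by exists (rep q)@_[::].
Qed.
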